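(* For every sequence $l=(l_i)_{i\in\mathbb{N}}$ of natural numbers (positive integers), the $l$-Grigorchuk subshift $\Omega(\eta_l)$ is aperiodic.
   Context: Let $\mathbb{N}=\{1,2,\dots\}$ and $\mathbb{N}_0=\mathbb{N}\cup\{0\}$. For an infinite word $w$ over a finite alphabet, $\Omega(w)$ is the closure (product of discrete topologies) of $\{\sigma^k(w):k\in\mathbb{N}_0\}$, where $\sigma$ is the left-shift. A subshift $Y$ is aperiodic if it contains no element $y$ with $\sigma^k(y)=y$ for some $k\in\mathbb{N}$. $l$-Grigorchuk subshift: On the alphabet $\{a,x,y,z\}$, for $\beta\in\{x,y,z\}$ let $\tau_\beta$ be the monoid homomorphism (under concatenation) of finite words with $\tau_\beta(a)=a\beta a$, $\tau_\beta(x)=x$, $\tau_\beta(y)=y$, $\tau_\beta(z)=z$. Put $\beta_k=x,y,z$ according as $k\equiv1,2,0\pmod 3$. For $j\in\mathbb{N}_0$ let $N(j)\ge1$ and $q(j)$ be the unique integers with $j=q(j)+\sum_{i=1}^{N(j)-1}l_i$ and $0\le q(j)<l_{N(j)}$, and put $\tau^{(j)}=\tau_{\beta_1}^{l_1}\circ\tau_{\beta_2}^{l_2}\circ\cdots\circ\tau_{\beta_{N(j)-1}}^{l_{N(j)-1}}\circ\tau_{\beta_{N(j)}}^{q(j)}$ (so $\tau^{(0)}$ is the identity). Then $\eta_l$ is the unique infinite word having $\tau^{(j)}(a)$ as a prefix for all $j\in\mathbb{N}_0$, and $\Omega(\eta_l)$ is the $l$-Grigorchuk subshift. *)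

(* Defs.v *)
From HB Require Import structures.
From mathcomp Require Import all_boot all_order.
From mathcomp Require Import boolp classical_sets functions topology.

Set Implicit Arguments.
Unset Strict Implicit.
Unset Printing Implicit Defensive.

Local Open Scope classical_set_scope.
Local Open Scope nat_scope.

(* Infinite words are indexed from 0. *)
Definition infinite_word (A : finType) : topologicalType :=
  prod_topology (fun _ : nat => discrete_topology A).

Definition shift (A : finType) (w : infinite_word A) : infinite_word A :=
  fun n => w n.+1.

Definition orbit_closure (A : finType) (w : infinite_word A) :
    set (infinite_word A) :=
  closure [set iter k (@shift A) w | k in [set: nat]].

Definition aperiodic (A : finType) (Y : set (infinite_word A)) : Prop :=
  ~ exists y, Y y /\ exists k, 0 < k /\ iter k (@shift A) y = y.

Definition is_prefix (A : finType) (s : seq A) (w : infinite_word A) : Prop :=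
  s = mkseq w (size s).

Inductive letter : Type := La | Lx | Ly | Lz.

Definition letter_code (c : letter) : 'I_4 :=
  match c with
  | La => inord 0 | Lx => inord 1 | Ly => inord 2 | Lz => inord 3
  end.

Definition letter_decode (i : 'I_4) : letter := nth La [:: La; Lx; Ly; Lz] i.

Lemma letter_codeK : cancel letter_code letter_decode.
Proof. by case; rewrite /letter_decode /= inordK. Qed.

HB.instance Definition _ := Countable.copy letter (can_type letter_codeK).
HB.instance Definition _ : isFinite letter := CanIsFinite letter_codeK.

Definition tau_letter (b c : letter) : seq letter :=
  if c is La then [:: La; b; La] else [:: c].

Definition tau (b : letter) (s : seq letter) : seq letter :=
  flatten (map (tau_letter b) s).

Definition beta (k : nat) : letter :=
  match k %% 3 with 1 => Lx | 2 => Ly | _ => Lz end.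

(* The sequence l is indexed by the positive integers: l 0 is never used. *)

(* N and q are N(j) and q(j). *)
Definition level (l : nat -> nat) (j N q : nat) : Prop :=
  [/\ 0 < N, j = q + \sum_(1 <= i < N) l i & q < l N].

(* bigop folds to the right, so this is
   tau_{beta 1}^{l 1} \o (... \o (tau_{beta (N-1)}^{l (N-1)} \o id))
   precomposed with tau_{beta N}^q. *)
Definition tau_comp (l : nat -> nat) (N q : nat) : seq letter -> seq letter :=
  (\big[(fun f g => f \o g)/id]_(1 <= i < N) iter (l i) (tau (beta i)))
    \o iter q (tau (beta N)).

Definition is_eta (l : nat -> nat) (w : infinite_word letter) : Prop :=
  forall j N q, level l j N q -> is_prefix (tau_comp l N q [:: La]) w.

(* The word w with is_eta l w, which exists and is unique by eta_unique when
   l is positive; the default value is irrelevant in that case. *)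
Definition eta (l : nat -> nat) : infinite_word letter :=
  xget ((fun _ => La) : infinite_word letter) [set w | is_eta l w].

Definition grigorchuk_subshift (l : nat -> nat) : set (infinite_word letter) :=
  orbit_closure (eta l).

Section Well_definedness.
Variable l : nat -> nat.
Hypothesis l_gt0 : forall i, 0 < i -> 0 < l i.

Lemma level_succ j N q : level l j N q ->
  level l j.+1 N q.+1 \/ q.+1 = l N /\ level l j.+1 N.+1 0.
Proof.
move=> [N0 -> qlt]; case: (ltnP q.+1 (l N)) => h; first by left.
have e : q.+1 = l N by apply/eqP; rewrite eqn_leq qlt h.
right; split => //; split => //; last exact: l_gt0.
by rewrite big_nat_recr //= -e add0n addnC addnS addnC.
Qed.

Lemma level_ex j : exists N q, level l j N q.
Proof.
elim: j => [|j [N [q /level_succ [h|[_ h]]]]].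
- by exists 1, 0; split => //; [rewrite big_geq | exact: l_gt0].
- by exists N, q.+1.
- by exists N.+1, 0.
Qed.

Lemma level_unique j N q N' q' :
  level l j N q -> level l j N' q' -> N = N' /\ q = q'.
Proof.
have half a b qa qb : level l j a qa -> level l j b qb -> a < b -> False.
  move=> [a0 ja qa_lt] [b0 jb _] ab.
  suff: j < j by rewrite ltnn.
  rewrite [in ltnRHS]jb ja (@big_cat_nat _ _ _ a.+1 1 b) //= big_nat_recr //=.
  apply: leq_trans (leq_addl _ _); apply: leq_trans (leq_addr _ _).
  by rewrite addnC ltn_add2l.
move=> h h'; have e : N = N'.
  by case: (ltngtP N N') => //; [move/(half _ _ _ _ h h') | move/(half _ _ _ _ h' h)].
split=> //; case: h h' => _ -> _ [_ + _]; rewrite e.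
by move/eqP; rewrite eqn_add2r => /eqP.
Qed.

Lemma tau_cat b s t : tau b (s ++ t) = tau b s ++ tau b t.
Proof. by rewrite /tau map_cat flatten_cat. Qed.

Lemma iter_tau_cat n b s t :
  iter n (tau b) (s ++ t) = iter n (tau b) s ++ iter n (tau b) t.
Proof. by elim: n => //= n ->; rewrite tau_cat. Qed.

Lemma tau_comp_cat N q s t :
  tau_comp l N q (s ++ t) = tau_comp l N q s ++ tau_comp l N q t.
Proof.
rewrite /tau_comp /= iter_tau_cat.
move: (iter q _ s) (iter q _ t) => {}s {}t.
elim/big_rec: _ s t => //= i f _ IH s t.
by rewrite IH iter_tau_cat.
Qed.

Lemma size_tau b s : size s <= size (tau b s).
Proof.
elim: s => //= c s IH; rewrite /tau /= size_cat -/(tau b s).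
by case: c => //=; rewrite ltnS; do 2 apply: leqW.
Qed.

Lemma size_iter_tau n b s : size s <= size (iter n (tau b) s).
Proof. by elim: n => //= n IH; apply: leq_trans IH (size_tau _ _). Qed.

Lemma size_tau_comp N q s : size s <= size (tau_comp l N q s).
Proof.
rewrite /tau_comp /=; apply: leq_trans (size_iter_tau q (beta N) s) _.
move: (iter q _ s) => {}s; elim/big_rec: _ s => //= i f _ IH s.
exact: leq_trans (IH s) (size_iter_tau _ _ _).
Qed.

Lemma tau_comp_succ N q s :
  tau_comp l N q.+1 s = tau_comp l N q (tau (beta N) s).
Proof. by rewrite /tau_comp /= -iterS iterSr. Qed.

Lemma tau_comp_next N s : 0 < N -> tau_comp l N.+1 0 s = tau_comp l N (l N) s.
Proof.
move=> N0; rewrite /tau_comp /= /index_iota subn1 /= -{1}(prednK N0).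
rewrite -[N.-1.+1]addn1 iotaD big_cat_nested big_cons big_nil /=.
rewrite add1n (prednK N0) subn1.
by elim: (iota 1 N.-1) => [|i r IH]; rewrite ?big_nil // !big_cons /= IH.
Qed.

Lemma level_tau_succ j N q N' q' : level l j N q -> level l j.+1 N' q' ->
  tau_comp l N' q' [:: La] = tau_comp l N q (tau (beta N) [:: La]).
Proof.
move=> h h'; case: (level_succ h) => [h2|[e h2]].
  by have [-> ->] := level_unique h' h2; rewrite tau_comp_succ.
have [-> ->] := level_unique h' h2; case: h => N0 _ _.
by rewrite tau_comp_next // -e tau_comp_succ.
Qed.

Lemma level_grow j N q N' q' : level l j N q -> level l j.+1 N' q' ->
  exists2 t, 0 < size t &
    tau_comp l N' q' [:: La] = tau_comp l N q [:: La] ++ t.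
Proof.
move=> h h'; exists (tau_comp l N q [:: beta N; La]).
  exact: leq_trans (size_tau_comp _ _ _).
by rewrite (level_tau_succ h h') -tau_comp_cat.
Qed.

Lemma level_size j N q : level l j N q -> j < size (tau_comp l N q [:: La]).
Proof.
elim: j N q => [|j IH] N q h; first exact: leq_trans (size_tau_comp N q [:: La]).
have [N0 [q0 h0]] := level_ex j.
have [t t0 ->] := level_grow h0 h.
rewrite size_cat -addn1; exact: leq_add (IH _ _ h0) t0.
Qed.

Lemma level_prefix j k N q N' q' : j <= k -> level l j N q -> level l k N' q' ->
  prefix (tau_comp l N q [:: La]) (tau_comp l N' q' [:: La]).
Proof.
move=> jk h; elim: k jk N' q' => [|k IH] jk N' q' h'.
  move: jk h'; rewrite leqn0 => /eqP j0; rewrite -j0 => h'.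
  by have [-> ->] := level_unique h h'; rewrite prefix_refl.
move: jk; rewrite leq_eqVlt => /orP[/eqP jk|].
  by move: h'; rewrite -jk => h'; have [-> ->] := level_unique h h'; rewrite prefix_refl.
rewrite ltnS => jk; have [N0 [q0 h0]] := level_ex k.
have [t _ ->] := level_grow h0 h'.
exact: prefix_trans (IH jk _ _ h0) (prefix_prefix _ _).
Qed.

Lemma eta_unique : exists! w, is_eta l w.
Proof.
have cj j : {p : nat * nat | level l j p.1 p.2}.
  by apply: cid; have [N [q h]] := level_ex j; exists (N, q).
pose T j := tau_comp l (projT1 (cj j)).1 (projT1 (cj j)).2 [:: La].
have TE j N q : level l j N q -> tau_comp l N q [:: La] = T j.
  by move=> h; rewrite /T; case: (cj j) => p /= hp; have [-> ->] := level_unique h hp.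
have Tsize j : j < size (T j) by rewrite /T; case: (cj j) => p /= /level_size.
have Tpre j k : j <= k -> prefix (T j) (T k).
  by move=> jk; rewrite /T; case: (cj j) => p /= hp; case: (cj k) => p' /= hp';
    exact: level_prefix jk hp hp'.
have Tnth j k i : j <= k -> i < size (T j) -> nth La (T k) i = nth La (T j) i.
  by move=> /Tpre /prefixP[t ->] hi; rewrite nth_cat hi.
exists (fun n => nth La (T n) n); split.
  move=> j N q h; rewrite (TE _ _ _ h) /is_prefix.
  apply: (@eq_from_nth _ La) => [|i hi]; first by rewrite size_mkseq.
  rewrite nth_mkseq //; case: (leqP i j) => ij; first exact: Tnth.
  by rewrite (Tnth j i) // ltnW.
move=> w hw; apply/funext => n.
case En : (cj n) => [p hp].
have := hw _ _ _ hp; rewrite (TE _ _ _ hp) /is_prefix => e.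
by rewrite {1}e nth_mkseq.
Qed.

Lemma etaP : is_eta l (eta l).
Proof.
have [w [hw _]] := eta_unique.
exact: (@xgetPex _ _ [set w | is_eta l w]) (ex_intro _ w hw).
Qed.

End Well_definedness.

(* Main.v *)
Require Import Defs.
From mathcomp Require Import all_boot.
From mathcomp Require Import boolp classical_sets topology.
From mathcomp Require Import zify.

(** The word [eta l] is a ruler word: counting positions from 1, its letter at
position n depends only on the 2-adic valuation v of n.  This holds because the
prefixes T_j of [eta l] satisfy T_{j+1} = T_j c_j T_j with c_j = beta (N(j)) and
size 2 ^ (j+1) - 1, so that c_j fills the positions of valuation j + 1, and the
letter a the odd ones ([eta_ruler]).

A point of the subshift with period p would give arbitrarily long stretches of
[eta l] on which the letters at positions n and n + p agree.  Write e for the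
valuation of p.  Whenever V > e is the valuation of some n, that of n + p is e,
and a long stretch contains an n of any prescribed valuation V.  Hence the
letters attached to all V > e would equal the one attached to e.  This is
absurd as soon as the letters attached to the valuations do not stabilise
([ruler_aperiodic]); here beta (N(j)) changes each time N(j)
increases, and N(j) is unbounded because every l i is finite. *)

Lemma iter_shiftE {A : finType} k (w : infinite_word A) n :
  iter k (@shift A) w n = w (k + n).
Proof. by elim: k n => // k IH n; rewrite iterS /shift IH addnS addSn. Qed.

(** Fixing finitely many letters of [y] defines a neighbourhood of [y] in the
product of discrete topologies, so it meets the orbit of [w]. *)
Lemma orbit_closure_factor {A : finType} (w y : infinite_word A) :
  orbit_closure w y -> forall L, exists m, forall i, i < L -> y i = w (m + i).
Proof.
move=> wy L.
have nbhs_coord i : nbhs y [set x : infinite_word A | x i = y i]%classic.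
  have := @proj_continuous nat (fun=> discrete_topology A) i y.
  exact: (fun c => c _ (discrete_set1 (y i : discrete_topology A))).
have nbhs_word : nbhs y [set x : infinite_word A | forall i, i < L -> x i = y i]%classic.
  elim: L => [|L IH]; first exact: filterS filterT.
  apply: filterS (filterI IH (nbhs_coord L)) => x [xL xLL] i.
  by rewrite ltnS leq_eqVlt => /orP[/eqP->|/xL].
have [_ [[m _ <-] xy]] := wy _ nbhs_word.
by exists m => i /xy <-; rewrite iter_shiftE.
Qed.

(** The ultrametric equality for the p-adic valuation. *)
Lemma lognD_lt p m n : prime p -> 0 < m -> logn p m < logn p n ->
  logn p (n + m) = logn p m.
Proof.
move=> p_pr m0 mn; have n0 : 0 < n by case: n mn => //; rewrite logn0.
have nm0 : 0 < n + m by rewrite addn_gt0 n0.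
apply/eqP; rewrite eqn_leq leqNgt -pfactor_dvdn //.
rewrite dvdn_addr ?pfactor_dvdn // ltnn /=.
by rewrite -pfactor_dvdn // dvdn_add // pfactor_dvdn // ltnW.
Qed.

Lemma logn2_odd_pow t V : logn 2 (t.*2.+1 * 2 ^ V) = V.
Proof.
rewrite lognM ?expn_gt0 // pfactorK // logn_coprime //.
by rewrite coprime2n /= odd_double.
Qed.

Lemma ruler_aperiodic {A : finType} (f : nat -> A) (w : infinite_word A) :
    (forall n, w n = f (logn 2 n.+1)) ->
    (forall e, exists2 V, e < V & f V <> f e) ->
  aperiodic (orbit_closure w).
Proof.
move=> wE f_var [y [wy [p [p0 yp]]]].
have yP n : y (n + p) = y n by rewrite addnC -iter_shiftE yp.
have [V eV fVe] := f_var (logn 2 p).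
have [m mP] := orbit_closure_factor w y wy (3 * 2 ^ V + p).
have pow0 : 0 < 2 ^ V by rewrite expn_gt0.
(* A number of valuation V shortly after m: the half period 2 ^ V is added to the
   first multiple of 2 ^ V.+1 that exceeds m. *)
pose n := (m %/ (2 ^ V).*2).+1.*2.+1 * 2 ^ V.
have m_lt_n : m < n.
  rewrite /n; have := @ltn_ceil m (2 ^ V).*2; rewrite double_gt0 => /(_ pow0).
  by move: (2 ^ V) pow0 (_ %/ _) => u u0 t; nia.
have n_le : n <= m + 3 * 2 ^ V.
  by rewrite /n; have := leq_trunc_div m (2 ^ V).*2; move: (2 ^ V) (_ %/ _) => u t; nia.
have nE : m + (n - m).-1 = n.-1 by lia.
have npE : m + ((n - m).-1 + p) = (n + p).-1 by lia.
have n0 : 0 < n by apply: leq_ltn_trans m_lt_n.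
have vn : logn 2 n = V by exact: logn2_odd_pow.
apply: fVe; have := yP (n - m).-1; rewrite !mP; [|lia|lia].
have np0 : 0 < n + p by rewrite addn_gt0 n0.
rewrite npE nE !wE (prednK n0) (prednK np0).
by rewrite lognD_lt // vn // => ->.
Qed.

Section Eta.
Variable l : nat -> nat.
Hypothesis l_gt0 : forall i, 0 < i -> 0 < l i.

(* The existence of N(j) and q(j) is only known as a proposition, so they are
   extracted by choice; [level_unique] makes the choice immaterial. *)
Let N j := sval (cid (level_ex l_gt0 j)).
Let q j := sval (cid (svalP (cid (level_ex l_gt0 j)))).
Let levelP j : level l j (N j) (q j) :=
  svalP (cid (svalP (cid (level_ex l_gt0 j)))).
Let T j := tau_comp l (N j) (q j) [:: La].

Definition ruler_letter v := if v is j.+1 then beta (N j) else La.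

Lemma ruler_letterE j M r : level l j M r -> ruler_letter j.+1 = beta M.
Proof. by move=> h /=; have [-> _] := level_unique (levelP j) h. Qed.

(** For e > 0 the witness is j + 1, where j is the first index with
N(j) = N(e - 1) + 1: consecutive values of [beta] differ.  For e = 0 any letter other
than a will do. *)
Lemma ruler_letter_var e : exists2 V, e < V & ruler_letter V <> ruler_letter e.
Proof.
case: e => [|e].
  by exists 1 => //=; rewrite /beta; case: (_ %% 3) => [|[|[]]].
have [N0 eE q_lt] := levelP e.
pose j := 0 + \sum_(1 <= i < (N e).+1) l i.
have h : level l j (N e).+1 0 by split => //; exact: l_gt0.
exists j.+1.
  by rewrite ltnS eE /j add0n big_nat_recr //= addnC ltn_add2l.
rewrite (ruler_letterE _ _ _ h) (ruler_letterE _ _ _ (levelP e)) /beta.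
rewrite -addn1 -modnDml.
by have := ltn_pmod (N e) (isT : 0 < 3); case: (_ %% 3) => [|[|[]]].
Qed.

(** The images of single letters other than a are themselves, which is what
turns tau^(j) (a b a) into T_j b T_j. *)
Lemma tau_comp_fixed M r b : b <> La -> tau_comp l M r [:: b] = [:: b].
Proof.
move=> bNa; have iter_fixed k c : iter k (tau c) [:: b] = [:: b].
  by elim: k => //= k ->; case: b bNa.
rewrite /tau_comp /= iter_fixed.
by elim/big_rec: _ => //= i g _ ->.
Qed.

Lemma T_succ j : T j.+1 = T j ++ ruler_letter j.+1 :: T j.
Proof.
rewrite /T (level_tau_succ l_gt0 (levelP j) (levelP j.+1)) /=.
rewrite -[tau _ _]/([:: La] ++ [:: beta (N j)] ++ [:: La]) !tau_comp_cat.
have betaNa : beta (N j) <> La by rewrite /beta; case: (_ %% 3) => [|[|[]]].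
by rewrite (tau_comp_fixed _ _ _ betaNa).
Qed.

(** The middle letter of T_{j+1} sits at position 2 ^ (j+1); to its right the
positions are shifted by that amount, which leaves the smaller valuations of
the second copy of T_j intact. *)
Lemma T_ruler j : T j = mkseq (fun n => ruler_letter (logn 2 n.+1)) (2 ^ j.+1).-1.
Proof.
elim: j => [|j IH].
  rewrite /T; have h : level l 0 1 0 by split; rewrite ?big_geq //; exact: l_gt0.
  have [-> ->] := level_unique (levelP 0) h.
  by rewrite /tau_comp /= big_geq.
have pow0 : 0 < 2 ^ j.+1 by rewrite expn_gt0.
have sizeE : (2 ^ j.+2).-1 = (2 ^ j.+1).-1 + (2 ^ j.+1).-1.+1.
  by rewrite [2 ^ j.+2]expnS; lia.
rewrite T_succ IH sizeE /mkseq iotaD map_cat /= add0n prednK // pfactorK //.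
rewrite -[in iota (2 ^ j.+1)](addn0 (2 ^ j.+1)) iotaDl -map_comp.
congr (_ ++ _ :: _); apply/eq_in_map => n; rewrite mem_iota add0n /= => n_lt.
rewrite -addnS lognD_lt // pfactorK //.
by rewrite ltnNge -pfactor_dvdn //; apply: contraTN n_lt => /dvdn_leq; lia.
Qed.

Lemma eta_ruler n : eta l n = ruler_letter (logn 2 n.+1).
Proof.
have := etaP l_gt0 (levelP n); rewrite -/(T n) T_ruler /is_prefix size_mkseq.
have n_lt : n < (2 ^ n.+1).-1.
  by have := ltn_expl n.+1 (isT : 1 < 2); lia.
by move/(congr1 (fun s => nth La s n)); rewrite !nth_mkseq.
Qed.

End Eta.

Theorem corollary4p16 (l : nat -> nat) (hl : forall i, 0 < i -> 0 < l i) :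
  aperiodic (grigorchuk_subshift l).
Proof.
exact: ruler_aperiodic (eta_ruler l hl) (ruler_letter_var l hl).
Qed.
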